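(* Let $1\le k\le n$, $x=(x',x'')\in\mathbb{R}^k\times\mathbb{R}^{n-k}$, $1<p,q<\infty$, $0<r<\infty$ with $p+q\ge r$, $\delta\in[0,1]\cap\left[\frac{r-q}{r},\frac{p}{r}\right]$, and $\alpha,b,c\in\mathbb{R}$ with $\frac{\delta r}{p}+\frac{(1-\delta)r}{q}=1$ and $c=-\delta+b(1-\delta)$. Then for every complex-valued $f\in C_0^\infty(\mathbb{R}^n\setminus\{x'=0\})$, $$\left|\frac{k-\alpha}{p}\right|^\delta\left\||x'|_k^{\alpha c/p}f\right\|_{L^r(\mathbb{R}^n)}\le\left[\left\|\frac{x'\cdot\nabla_kf}{|x'|_k^{\alpha/p}}\right\|_{L^p(\mathbb{R}^n)}^p-\int_{\mathbb{R}^n}C_p\!\left(\frac{x'\cdot\nabla_kf}{|x'|_k^{\alpha/p}},\frac{x'\cdot\nabla_kf}{|x'|_k^{\alpha/p}}+\frac{k-\alpha}{p}\frac{f}{|x'|_k^{\alpha/p}}\right)dx\right]^{\delta/p}\left\||x'|_k^{\alpha b/p}f\right\|_{L^q(\mathbb{R}^n)}^{1-\delta}$$ (the bracket being nonnegative). Moreover, when $\alpha\neq k$, the constant $\left|\frac{k-\alpha}{p}\right|^\delta$ is sharp in the case $q=p$ with $b=-1$, and in the cases $\delta\in\{0,1\}$.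
   Context: $|\cdot|_k$ is the Euclidean norm on $\mathbb{R}^k$, $\nabla_k=(\partial_{x_1},\dots,\partial_{x_k})$, $x'\cdot\nabla_kf=\sum_{j=1}^kx_j\partial_{x_j}f$. For complex $\xi,\eta$, $C_p(\xi,\eta):=|\xi|^p-|\xi-\eta|^p-p|\xi-\eta|^{p-2}\operatorname{Re}((\xi-\eta)\overline{\eta})$ (last term $0$ when $\xi=\eta$). Sharp means the constant on the left cannot be replaced by any larger constant. *)

(* Defs.v *)
From HB Require Import structures.
From mathcomp Require Import all_boot all_order all_algebra.
From mathcomp Require Import all_classical all_reals all_analysis.
Set Implicit Arguments. Unset Strict Implicit. Unset Printing Implicit Defensive.
Import Order.TTheory GRing.Theory Num.Theory.
Import numFieldNormedType.Exports.
Local Open Scope classical_set_scope.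
Local Open Scope ring_scope.

Section Defs.
Variable R : realType.

Definition cplx := (R * R)%type.
Definition cabs (z : cplx) : R := Num.sqrt (z.1 ^+ 2 + z.2 ^+ 2).
Definition cRe_mul_conj (z w : cplx) : R := z.1 * w.1 + z.2 * w.2.
Definition csub (z w : cplx) : cplx := (z.1 - w.1, z.2 - w.2).
Definition cadd (z w : cplx) : cplx := (z.1 + w.1, z.2 + w.2).
Definition cscale (a : R) (z : cplx) : cplx := (a * z.1, a * z.2).

Definition Cp (p : R) (xi eta : cplx) : R :=
  cabs xi `^ p - cabs (csub xi eta) `^ p -
  (if xi == eta then 0
   else p * cabs (csub xi eta) `^ (p - 2) * cRe_mul_conj (csub xi eta) eta).

(* Lebesgue integral over R^n = 'rV[R]_n of a nonnegative function, defined
   as the iterated one-dimensional Lebesgue integral (Tonelli). *)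
Fixpoint intRn (n : nat) : ('rV[R]_n -> \bar R) -> \bar R :=
  match n with
  | 0 => fun g => g 0
  | n'.+1 => fun g =>
      (\int[@lebesgue_measure R]_(t in setT)
         intRn (fun y : 'rV[R]_n' => g (row_mx (\row_(i < 1) t) y)))%E
  end.

Definition LnormRn (n : nat) (s : R) (g : 'rV[R]_n -> cplx) : R :=
  fine (intRn (fun x => (cabs (g x) `^ s)%:E)) `^ (s^-1).

Definition xnorm (n k : nat) (x : 'rV[R]_n) : R :=
  Num.sqrt (\sum_(i < n | (i < k)%N) x 0 i ^+ 2).

Definition partial (n : nat) (g : 'rV[R]_n -> R) (i : 'I_n) (x : 'rV[R]_n) : R :=
  'D_(delta_mx 0 i) g x.

Definition xgrad (n k : nat) (g : 'rV[R]_n -> R) (x : 'rV[R]_n) : R :=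
  \sum_(i < n | (i < k)%N) x 0 i * partial g i x.

Fixpoint iterD (n : nat) (vs : seq 'rV[R]_n) (g : 'rV[R]_n -> R) : 'rV[R]_n -> R :=
  match vs with
  | [::] => g
  | v :: vs' => iterD vs' ('D_v g)
  end.

Definition smooth (n : nat) (g : 'rV[R]_n -> R) : Prop :=
  forall (vs : seq 'rV[R]_n) (x : 'rV[R]_n), differentiable (iterD vs g) x.

(* f = u + i v belongs to C_0^infinity(R^n \ {x' = 0}) *)
Definition test_fun (n k : nat) (u v : 'rV[R]_n -> R) : Prop :=
  smooth u /\ smooth v /\
  exists K : set 'rV[R]_n, compact K /\ K `<=` [set x | xnorm k x != 0] /\
    (forall x, ~ K x -> u x = 0 /\ v x = 0).

Definition cfun (n : nat) (u v : 'rV[R]_n -> R) (x : 'rV[R]_n) : cplx := (u x, v x).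

Definition gradw (n k : nat) (p alpha : R) (u v : 'rV[R]_n -> R) (x : 'rV[R]_n) : cplx :=
  cscale ((xnorm k x `^ (alpha / p))^-1) (xgrad k u x, xgrad k v x).

Definition gradw_shift (n k : nat) (p alpha : R) (u v : 'rV[R]_n -> R) (x : 'rV[R]_n) : cplx :=
  cadd (gradw k p alpha u v x)
       (cscale ((k%:R - alpha) / p * (xnorm k x `^ (alpha / p))^-1) (cfun u v x)).

Definition bracket (n k : nat) (p alpha : R) (u v : 'rV[R]_n -> R) : R :=
  LnormRn p (gradw k p alpha u v) `^ p -
  fine (intRn (fun x => (Cp p (gradw k p alpha u v x) (gradw_shift k p alpha u v x))%:E)).

Definition wnorm (n k : nat) (s e : R) (u v : 'rV[R]_n -> R) : R :=
  LnormRn s (fun x => cscale (xnorm k x `^ e) (cfun u v x)).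

End Defs.

(* Main.v *)
Require Import Defs.
From HB Require Import structures.
From mathcomp Require Import all_boot all_order all_algebra.
From mathcomp Require Import all_classical all_reals all_analysis.
From mathcomp Require Import ring lra.
Set Implicit Arguments. Unset Strict Implicit. Unset Printing Implicit Defensive.
Import Order.TTheory GRing.Theory Num.Theory.
Import numFieldNormedType.Exports.
Local Open Scope classical_set_scope.
Local Open Scope ring_scope.

(** Put [m = (k - alpha)/p] and [w = |x'|^(-alpha/p)].  Under the dilations
    [x' |-> e^s x'] the integral of a function [g] is multiplied by [e^(-ks)];
    differentiating at [s = 0] for [g = w^p |f|^p] gives
      [p int w^p |f|^(p-2) <f, x'.grad f> = (alpha - k) int w^p |f|^p].
    Since [C_p(xi, eta)] only involves [|xi|], [|xi - eta|] and
    [<xi - eta, xi>], this collapses the bracket to [(|m| ||w f||_p)^p] for every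
    test function [f].  The inequality is then Hölder interpolation between
    weighted norms, and in the cases listed for sharpness it is an equality for
    every [f], so one [f <> 0] suffices. *)

(** * Continuous functions with compact support *)

Section CompactSupport.
Variables (R : realType) (V : normedModType R).
Implicit Types g h : V -> R.

Definition vanishes_beyond (M : R) g := forall x, M < `|x| -> g x = 0.

Definition Cc g := continuous g /\ exists M : R, vanishes_beyond M g.

Lemma vanishes_beyondW (M N : R) g :
  M <= N -> vanishes_beyond M g -> vanishes_beyond N g.
Proof. by move=> MN gM x Nx; apply: gM; exact: le_lt_trans Nx. Qed.

Lemma vanishes_beyond_maxl (M N : R) g :
  vanishes_beyond M g -> vanishes_beyond (Num.max M N) g.
Proof. by apply: vanishes_beyondW; rewrite le_max lexx. Qed.

Lemma vanishes_beyond_maxr (M N : R) g :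
  vanishes_beyond N g -> vanishes_beyond (Num.max M N) g.
Proof. by apply: vanishes_beyondW; rewrite le_max lexx orbT. Qed.

Lemma vanishes_beyondB (M : R) g h : vanishes_beyond M g -> vanishes_beyond M h ->
  vanishes_beyond M (fun x => g x - h x).
Proof. by move=> gM hM x Mx; rewrite gM// hM// subrr. Qed.

Lemma Cc_continuous g : Cc g -> continuous g. Proof. by case. Qed.

Lemma Cc_radius g : Cc g -> exists2 M : R, 0 < M & vanishes_beyond M g.
Proof.
move=> [_ [M gM]]; exists (Num.max 1 M); first by rewrite lt_max ltr01.
exact: vanishes_beyond_maxr.
Qed.

Lemma Cc_cst0 : Cc (fun=> 0).
Proof. by split; [exact: cst_continuous|exists 0]. Qed.

Lemma CcD g h : Cc g -> Cc h -> Cc (fun x => g x + h x).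
Proof.
move=> [cg [M gM]] [ch [N hN]]; split.
  by move=> x; apply: continuousD; [exact: cg|exact: ch].
exists (Num.max M N) => x xMN.
by rewrite (vanishes_beyond_maxl gM xMN) (vanishes_beyond_maxr hN xMN) addr0.
Qed.

Lemma CcMl g h : continuous g -> Cc h -> Cc (fun x => g x * h x).
Proof.
move=> cg [ch [N hN]]; split.
  by move=> x; apply: continuousM; [exact: cg|exact: ch].
by exists N => // x xN; rewrite hN// mulr0.
Qed.

Lemma CcZ (a : R) h : Cc h -> Cc (fun x => a * h x).
Proof. by apply: CcMl; exact: cst_continuous. Qed.

Lemma CcB g h : Cc g -> Cc h -> Cc (fun x => g x - h x).
Proof.
move=> cg ch; have /(CcD cg) := CcZ (-1) ch.
by under eq_fun do rewrite mulN1r.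
Qed.

Lemma Cc_comp (phi : R -> R) g : phi 0 = 0 -> (forall x, {for g x, continuous phi}) ->
  Cc g -> Cc (phi \o g).
Proof.
move=> phi0 cphi [cg [M gM]]; split.
  by move=> x; apply: continuous_comp; [exact: cg|exact: cphi].
by exists M => x xM; rewrite /= gM.
Qed.

End CompactSupport.

Section UniformContinuity.
Variable R : realType.

Lemma compact_near_dist_lt (X Y : topologicalType) (Q : X -> Y -> R) (K : set Y) s0 :
  compact K ->
  (forall y, K y -> {for (s0, y), continuous (fun sy : X * Y => Q sy.1 sy.2)}) ->
  forall e : R, 0 < e ->
  \forall s \near s0, forall y, K y -> `|Q s y - Q s0 y| < e.
Proof.
move=> /compact_near_coveringP cK cQ e e0.
apply: (cK _ (nbhs s0) (fun s y => `|Q s y - Q s0 y| < e)) => y Ky.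
have e20 : 0 < e / 2 by rewrite divr_gt0.
have /cvgrPdist_lt /(_ _ e20) /= := cQ y Ky.
move=> [[A B] /= [nA nB] AB].
exists (B, A) => //= -[y' s] [/= By' As].
have near_s := AB (s, y') (conj As By').
have near_s0 := AB (s0, y') (conj (nbhs_singleton nA) By').
by rewrite (splitr e) (le_lt_trans (ler_distD (Q s0 y) _ _))// ltrD// distrC.
Qed.

Lemma compact_norm_le n (M : R) : compact [set x : 'rV[R]_n | `|x| <= M].
Proof.
apply: bounded_closed_compact.
  by exists M; split; [exact: num_real|move=> N MN x /= xM; rewrite (le_trans xM)// ltW].
apply: (@preimage_closed _ _ (fun x : 'rV[R]_n => `|x|) [set r | r <= M]) => [x _|].
  exact: norm_continuous.
exact: closed_le.
Qed.

Lemma Cc_near_dist_lt (T : topologicalType) (W : normedModType R) n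
    (F : T -> 'rV[R]_n -> W) (g : W -> R) (t : T) (C : R) : Cc g ->
  continuous (fun sx : T * 'rV[R]_n => F sx.1 sx.2) ->
  (\forall s \near t, forall x, `|x| <= C * `|F s x|) ->
  forall e : R, 0 < e ->
  \forall s \near t, forall x, `|g (F s x) - g (F t x)| < e.
Proof.
move=> cg cF proper e e0; have [M M0 gM] := Cc_radius cg.
have /= near_ball := compact_near_dist_lt (Q := fun s x => g (F s x)) (s0 := t)
  (@compact_norm_le n (`|C| * M)) _ e0.
have {near_ball} : \forall s \near t, forall x, `|x| <= `|C| * M ->
    `|g (F s x) - g (F t x)| < e.
  apply: near_ball => x _; apply: (continuous_comp (cF (t, x))).
  exact: Cc_continuous cg _.
have vanishes s x : (forall x, `|x| <= C * `|F s x|) -> `|C| * M < `|x| -> g (F s x) = 0.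
  move=> properS xM; apply: gM; apply: contraTT (properS x); rewrite -ltNge -leNgt => FM.
  apply: le_lt_trans xM; apply: (le_trans (ler_wpM2r (normr_ge0 _) (ler_norm C))).
  exact: ler_wpM2l.
have propert := nbhs_singleton proper.
apply: filterS2 proper => s propers near_s x.
have [/near_s//|xM] := leP `|x| (`|C| * M).
by rewrite !vanishes// subrr normr0.
Qed.

Lemma Cc_compact_support n (K U : set 'rV[R]_n) (g : 'rV[R]_n -> R) :
  compact K -> K `<=` U ->
  (forall x, ~ K x -> g x = 0) -> (forall x, U x -> {for x, continuous g}) -> Cc g.
Proof.
move=> cK KU gK cg.
have oK : open (~` K).
  by apply: closed_openC; apply: compact_closed => //; exact: norm_hausdorff.
split=> [x|].
  have [Kx|Kx] := pselect (K x); first exact/cg/KU.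
  rewrite /continuous_at gK//; apply: (@cvg_near_cst _ _ _ _ (nbhs x)).
  by apply: filterS (open_nbhs_nbhs (conj oK Kx)) => y; exact: gK.
have [M [_ KM]] := compact_bounded cK.
exists (M + 1) => x xM; apply: gK => Kx.
have M1 : M < M + 1 by rewrite ltrDl.
by have := KM _ M1 x Kx; rewrite /= leNgt xM.
Qed.

End UniformContinuity.

Section LebesgueIntegral.
Variable R : realType.
Implicit Types G : R -> R.
Local Notation mu := (@lebesgue_measure R).

Lemma continuous_segment_integrable G (a b : R) : continuous G ->
  mu.-integrable `[a, b] (EFin \o G).
Proof.
move=> cG; apply: continuous_compact_integrable; first exact: segment_compact.
exact: continuous_subspaceT.
Qed.

Lemma vanishes_beyond_restrict G (M : R) : vanishes_beyond M G ->
  EFin \o G = (EFin \o G) \_ `[- M, M].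
Proof.
move=> GM; apply/funext => t; rewrite patchE; case: ifPn => // /negP tM /=.
by rewrite GM// ltNge; apply/negP => h; apply: tM; rewrite inE /= in_itv/= -ler_norml.
Qed.

Lemma Rintegral_segment G (M : R) : vanishes_beyond M G ->
  \int[mu]_t G t = \int[mu]_(t in `[- M, M]) G t.
Proof.
by move=> GM; rewrite /Rintegral [in RHS]integral_mkcond -(vanishes_beyond_restrict GM).
Qed.

Lemma Cc_integrable G : Cc G -> mu.-integrable setT (EFin \o G).
Proof.
move=> [cG [M GM]]; rewrite (vanishes_beyond_restrict GM) -integrable_mkcond//.
exact: continuous_segment_integrable.
Qed.

Lemma Rintegral_cst_segment (a b c : R) : a <= b ->
  \int[mu]_(_ in `[a, b]) c = c * (b - a).
Proof.
rewrite le_eqVlt Rintegral_cst//= lebesgue_measure_itv/= lte_fin.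
by move=> /predU1P[->|->//]; rewrite ltxx [in RHS]subrr.
Qed.

Lemma normr_Rintegral_le G (M c : R) : 0 < M -> continuous G -> vanishes_beyond M G ->
  (forall t, `|G t| <= c) -> `|\int[mu]_t G t| <= c * (2 * M).
Proof.
move=> M0 cG GM Gc; rewrite (Rintegral_segment GM).
have iG := continuous_segment_integrable (- M) M cG.
apply: (le_trans (le_normr_Rintegral _ iG)) => //.
apply: (@le_trans _ _ (\int[mu]_(t in `[- M, M]) c)).
  apply: le_Rintegral => //; first exact: (integrable_norm iG).
  by apply: (@continuous_segment_integrable (cst c)); exact: cst_continuous.
rewrite Rintegral_cst_segment; last lra.
by rewrite opprK -mulr2n mulr_natl.
Qed.

Lemma Rintegral_gt0 G t0 : Cc G -> (forall t, 0 <= G t) -> 0 < G t0 ->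
  0 < \int[mu]_t G t.
Proof.
move=> cG G0 Gt0; have iG := Cc_integrable cG.
have e0 : 0 < G t0 / 2 by rewrite divr_gt0.
have [continuousG _] := cG.
have /cvgrPdist_lt /(_ _ e0) /nbhs_ballP[d /= d0 near_t0] := continuousG t0.
set I := `[t0 - d / 2, t0 + d / 2].
have GI t : t \in I -> G t0 / 2 <= G t.
  rewrite in_itv/= => /andP[t0t tt0].
  have : `|G t0 - G t| < G t0 / 2.
    by apply: near_t0; rewrite /ball/= ltr_norml; lra.
  by rewrite ltr_norml => /andP[_]; lra.
apply: (@lt_le_trans _ _ (\int[mu]_(t in [set` I]) (G t0 / 2))).
  by rewrite Rintegral_cst_segment ?mulr_gt0//; lra.
apply: (@le_trans _ _ (\int[mu]_(t in [set` I]) G t)).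
  apply: le_Rintegral => //; last exact: integrableS iG.
  by apply: (@continuous_segment_integrable (cst _)); exact: cst_continuous.
rewrite Rintegral_mkcond; apply: le_Rintegral => //.
  by rewrite -restrict_EFin -integrable_mkcond//; exact: integrableS iG.
by move=> t _; rewrite patchE; case: ifPn.
Qed.

Lemma vanishes_beyond_scale G (a M : R) : 0 < a -> vanishes_beyond M G ->
  vanishes_beyond (M / a) (fun t => G (a * t)).
Proof.
move=> a0 GM t; rewrite ltr_pdivrMr// mulrC -{1}(gtr0_norm a0) -normrM.
exact: GM.
Qed.

Lemma Cc_scale G (a : R) : 0 < a -> Cc G -> Cc (fun t => G (a * t)).
Proof.
move=> a0 [cG [M GM]]; split.
  by move=> t; apply: continuous_comp; [exact: mulrl_continuous|exact: cG].
by exists (M / a); exact: vanishes_beyond_scale.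
Qed.

Lemma Rintegral_scale G (a : R) : 0 < a -> Cc G ->
  \int[mu]_t G (a * t) = a^-1 * \int[mu]_t G t.
Proof.
move=> a0 cG; have [M M0 GM] := Cc_radius cG.
have cGa := Cc_continuous (Cc_scale a0 cG).
have derM : derive1 ( *%R a : R -> R) = cst a.
  by apply/funext => z; rewrite derive1Ml// derive1_id mulr1.
rewrite (Rintegral_segment GM) (Rintegral_segment (vanishes_beyond_scale a0 GM)).
have := @integration_by_substitution_increasing R ( *%R a) G (- (M / a)) (M / a).
rewrite mulrN mulrCA divff ?gt_eqF// mulr1 derM => subst.
rewrite [in RHS]/Rintegral subst.
- under eq_integral do rewrite fctE/= mulrC EFinM.
  have iG := continuous_segment_integrable (- (M / a)) (M / a) cGa.
  by rewrite integralZl//= fineM//= ?mulKf ?gt_eqF//; exact: integrable_fin_num.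
- by rewrite ge0_cp// divr_ge0// ltW.
- by move=> x y _ _ xy; rewrite ltr_pM2l.
- by move=> z _; exact: cvg_cst.
- exact: is_cvg_cst.
- exact: is_cvg_cst.
- split => //.
  + by apply: cvg_at_right_filter; exact: mulrl_continuous.
  + by apply: cvg_at_left_filter; exact: mulrl_continuous.
- exact: continuous_subspaceT (Cc_continuous cG).
Qed.

End LebesgueIntegral.

(** * The iterated integral *)

Section Rows.
Variable R : realType.

Lemma cvg_rowP (T : Type) (F : set_system T) {FF : Filter F} n
    (f : T -> 'rV[R]_n) (l : 'rV[R]_n) :
  (forall i, (fun t => f t 0 i) @ F --> l 0 i) -> f @ F --> l.
Proof.
move=> fl A [B nB sBA]; rewrite /nbhs /=.
apply: (@filterS _ F _ [set t | forall i, B 0 i (f t 0 i)]).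
  by move=> t Bt; apply: sBA => i j; rewrite (ord1 i); exact: Bt.
by apply: filter_forall => i; exact: fl.
Qed.

Lemma continuous_rowP (T : topologicalType) n (f : T -> 'rV[R]_n) :
  (forall i, continuous (fun x => f x 0 i)) -> continuous f.
Proof. by move=> cf x; apply: (@cvg_rowP _ (nbhs x)) => i; exact: cf. Qed.

Lemma row_norm_leP n (x : 'rV[R]_n) (M : R) : 0 <= M ->
  (forall i, `|x 0 i| <= M) <-> `|x| <= M.
Proof.
move=> M0; rewrite [leLHS]mx_normrE; split=> [xM|/bigmax_leP[_ xM] i].
  by apply/bigmax_leP; split => // -[i j] _; rewrite (ord1 i); exact: xM.
exact: (xM (0, i)).
Qed.

Lemma row_coord_norm_le n (x : 'rV[R]_n) i : `|x 0 i| <= `|x|.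
Proof. exact: (row_norm_leP x (normr_ge0 x)).2. Qed.

Definition cons_row n (t : R) (y : 'rV[R]_n) : 'rV[R]_n.+1 := row_mx (\row_(i < 1) t) y.

Lemma cons_row0 n (t : R) (y : 'rV[R]_n) : cons_row t y 0 ord0 = t.
Proof.
rewrite /cons_row (_ : ord0 = lshift n (ord0 : 'I_1)); last exact: val_inj.
by rewrite (@row_mxEl _ 1 1 n) mxE.
Qed.

Lemma cons_rowS n (t : R) (y : 'rV[R]_n) i : cons_row t y 0 (lift ord0 i) = y 0 i.
Proof.
rewrite /cons_row (_ : lift ord0 i = rshift 1 i); last exact: val_inj.
by rewrite (@row_mxEr _ 1 1 n).
Qed.

Lemma cons_rowK n (x : 'rV[R]_n.+1) :
  cons_row (x 0 ord0) (\row_j x 0 (lift ord0 j)) = x.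
Proof.
apply/rowP => i.
by case: (unliftP ord0 i) => [j|] ->; rewrite ?cons_rowS ?cons_row0// mxE.
Qed.

Lemma cons_row_continuous n :
  continuous (fun ty : R * 'rV[R]_n => cons_row ty.1 ty.2).
Proof.
apply: continuous_rowP => i [t y]; case: (unliftP ord0 i) => [j|] ->.
  rewrite /continuous_at cons_rowS; under eq_fun do rewrite cons_rowS.
  apply: (cvg_comp snd (fun y : 'rV[R]_n => y 0 j)); first exact: cvg_snd.
  exact: coord_continuous.
by rewrite /continuous_at cons_row0; under eq_fun do rewrite cons_row0; exact: cvg_fst.
Qed.

Lemma le_normr_cons_row_head n (t : R) (y : 'rV[R]_n) : `|t| <= `|cons_row t y|.
Proof. by rewrite -{1}(cons_row0 t y) row_coord_norm_le. Qed.

Lemma le_normr_cons_row_tail n (t : R) (y : 'rV[R]_n) : `|y| <= `|cons_row t y|.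
Proof.
by apply/row_norm_leP => // i; rewrite -(cons_rowS t) row_coord_norm_le.
Qed.

Definition slice n (g : 'rV[R]_n.+1 -> R) t := fun y => g (cons_row t y).

Lemma slice_vanishes_beyond n (g : 'rV[R]_n.+1 -> R) (M t : R) :
  vanishes_beyond M g -> vanishes_beyond M (slice g t).
Proof.
by move=> gM y yM; apply: gM; exact: lt_le_trans (le_normr_cons_row_tail _ _).
Qed.

Lemma slice_eq0 n (g : 'rV[R]_n.+1 -> R) (M t : R) :
  vanishes_beyond M g -> M < `|t| -> slice g t = fun=> 0.
Proof.
move=> gM tM; apply/funext => y; apply: gM.
exact: lt_le_trans (le_normr_cons_row_head _ _).
Qed.

Lemma Cc_slice n (g : 'rV[R]_n.+1 -> R) t : Cc g -> Cc (slice g t).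
Proof.
move=> [cg [M gM]]; split; last by exists M; exact: slice_vanishes_beyond.
move=> y; apply: (continuous_comp (f := cons_row t)); last exact: cg.
apply: continuous_rowP => i z; case: (unliftP ord0 i) => [j|] ->.
  by under eq_fun do rewrite cons_rowS; exact: coord_continuous.
by under eq_fun do rewrite cons_row0; exact: cst_continuous.
Qed.

Lemma near_slice n (g : 'rV[R]_n.+1 -> R) t (e : R) : Cc g -> 0 < e ->
  \forall s \near t, forall y, `|slice g s y - slice g t y| < e.
Proof.
move=> cg; have := @Cc_near_dist_lt R R _ n (@cons_row n) g t 1 cg.
apply; first exact: cons_row_continuous.
by near=> s => y; rewrite mul1r le_normr_cons_row_tail.
Unshelve. all: by end_near. Qed.

End Rows.

Section IteratedIntegral.
Variable R : realType.
Local Notation mu := (@lebesgue_measure R).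

Fixpoint RintRn n : ('rV[R]_n -> R) -> R :=
  match n with
  | 0 => fun g => g 0
  | n'.+1 => fun g => \int[mu]_t RintRn (slice g t)
  end.

Lemma RintRn_cst0 n : RintRn (fun _ : 'rV[R]_n => 0) = 0.
Proof.
elim: n => //= n IH; under eq_Rintegral do rewrite IH.
by rewrite /Rintegral integral0.
Qed.

Let linear_on_Cc n := forall (a : R) (g h : 'rV[R]_n -> R), Cc g -> Cc h ->
  RintRn (fun x => a * g x + h x) = a * RintRn g + RintRn h.

Let bounded_on_Cc n := forall (g : 'rV[R]_n -> R) (M c : R), Cc g -> 0 < M ->
  vanishes_beyond M g -> (forall x, `|g x| <= c) -> `|RintRn g| <= c * (2 * M) ^+ n.

Let slice_vanishes n (g : 'rV[R]_n.+1 -> R) (M : R) :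
  vanishes_beyond M g -> vanishes_beyond M (fun t => RintRn (slice g t)).
Proof. by move=> gM t tM; rewrite (slice_eq0 gM tM) RintRn_cst0. Qed.

Let slice_continuous n (g : 'rV[R]_n.+1 -> R) :
  linear_on_Cc n -> bounded_on_Cc n -> Cc g -> continuous (fun t => RintRn (slice g t)).
Proof.
move=> lin bnd cg t; have [M M0 gM] := Cc_radius cg.
apply/cvgrPdist_le => e e0.
have volume_gt0 : 0 < (2 * M) ^+ n by rewrite exprn_gt0// mulr_gt0.
have e'0 : 0 < e / (2 * M) ^+ n by rewrite divr_gt0.
apply: filterS (near_slice t cg e'0) => s near_t.
have [ct cs] := (Cc_slice t cg, Cc_slice s cg).
rewrite distrC addrC -mulN1r -lin// -[leRHS](divfK (lt0r_neq0 volume_gt0)).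
under eq_fun do rewrite mulN1r addrC.
apply: bnd => //; first exact: CcB.
- by apply: vanishes_beyondB; exact: slice_vanishes_beyond.
- by move=> y; rewrite ltW.
Qed.

Let Cc_integral_slice n (g : 'rV[R]_n.+1 -> R) :
  linear_on_Cc n -> bounded_on_Cc n -> Cc g -> Cc (fun t => RintRn (slice g t)).
Proof.
move=> lin bnd cg; split; first exact: slice_continuous.
by have [_ [M gM]] := cg; exists M; exact: slice_vanishes.
Qed.

Let linear_bounded n : linear_on_Cc n /\ bounded_on_Cc n.
Proof.
elim: n => [|n [lin bnd]].
  by split=> [//|g M c _ _ _ gc /=]; rewrite expr0 mulr1.
have Cc_int g := @Cc_integral_slice n g lin bnd.
split=> [a g h cg ch|g M c cg M0 gM gc] /=.
- rewrite -RintegralZl//; last exact/Cc_integrable/Cc_int.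
  rewrite -RintegralD//.
  + by apply: eq_Rintegral => t _; rewrite -lin//; exact: Cc_slice.
  + exact/Cc_integrable/CcZ/Cc_int.
  + exact/Cc_integrable/Cc_int.
- rewrite exprS [2 * M * _]mulrC mulrA.
  apply: normr_Rintegral_le => //; first exact: slice_continuous.
    exact: slice_vanishes.
  move=> t; apply: bnd => //; [exact: Cc_slice|exact: slice_vanishes_beyond|].
  by move=> y; exact: gc.
Qed.

Lemma RintRn_linear n (a : R) (g h : 'rV[R]_n -> R) : Cc g -> Cc h ->
  RintRn (fun x => a * g x + h x) = a * RintRn g + RintRn h.
Proof. exact: (linear_bounded n).1. Qed.

Lemma normr_RintRn_le n (g : 'rV[R]_n -> R) (M c : R) : Cc g -> 0 < M ->
  vanishes_beyond M g -> (forall x, `|g x| <= c) -> `|RintRn g| <= c * (2 * M) ^+ n.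
Proof. exact: (linear_bounded n).2. Qed.

Lemma Cc_RintRn_slice n (g : 'rV[R]_n.+1 -> R) : Cc g -> Cc (fun t => RintRn (slice g t)).
Proof.
by have [] := linear_bounded n; exact: Cc_integral_slice.
Qed.

Lemma intRn_EFin n (g : 'rV[R]_n -> R) : Cc g -> intRn (EFin \o g) = (RintRn g)%:E.
Proof.
elim: n g => //= n IH g cg.
transitivity (\int[mu]_t (RintRn (slice g t))%:E)%E.
  by apply: eq_integral => t _; exact: IH (Cc_slice t cg).
rewrite fineK//; apply: integrable_fin_num => //.
exact: Cc_integrable (Cc_RintRn_slice cg).
Qed.

Lemma RintRnZ n (a : R) (g : 'rV[R]_n -> R) : Cc g ->
  RintRn (fun x => a * g x) = a * RintRn g.
Proof.
move=> cg; have := RintRn_linear a cg (@Cc_cst0 R _); rewrite RintRn_cst0 addr0 => <-.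
by under [in RHS]eq_fun do rewrite addr0.
Qed.

Lemma RintRnD n (g h : 'rV[R]_n -> R) : Cc g -> Cc h ->
  RintRn (fun x => g x + h x) = RintRn g + RintRn h.
Proof.
move=> cg ch; have := RintRn_linear 1 cg ch; rewrite mul1r => <-.
by under [in RHS]eq_fun do rewrite mul1r.
Qed.

Lemma RintRnB n (g h : 'rV[R]_n -> R) : Cc g -> Cc h ->
  RintRn (fun x => g x - h x) = RintRn g - RintRn h.
Proof.
move=> cg ch; rewrite addrC -mulN1r -RintRn_linear//.
by under [in RHS]eq_fun do rewrite mulN1r addrC.
Qed.

Lemma RintRn_ge0 n (g : 'rV[R]_n -> R) : (forall x, 0 <= g x) -> 0 <= RintRn g.
Proof.
elim: n g => [|n IH] g g0 //=; apply: Rintegral_ge0 => // t _.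
by apply: IH => y; exact: g0.
Qed.

Lemma ler_RintRn n (g h : 'rV[R]_n -> R) : Cc g -> Cc h -> (forall x, g x <= h x) ->
  RintRn g <= RintRn h.
Proof.
move=> cg ch gh; rewrite -subr_ge0 -RintRnB//; apply: RintRn_ge0 => x.
by rewrite subr_ge0.
Qed.

Lemma RintRn_gt0 n (g : 'rV[R]_n -> R) x0 : Cc g -> (forall x, 0 <= g x) -> 0 < g x0 ->
  0 < RintRn g.
Proof.
elim: n g x0 => [|n IH] g x0 cg g0 gx0.
  by rewrite /= (_ : 0 = x0)//; apply/rowP => -[].
apply: (Rintegral_gt0 (t0 := x0 0 ord0)); first exact: Cc_RintRn_slice.
  by move=> t; apply: RintRn_ge0 => y; exact: g0.
apply: (IH _ (\row_j x0 0 (lift ord0 j))); first exact: Cc_slice.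
  by move=> y; exact: g0.
by rewrite /slice cons_rowK.
Qed.

End IteratedIntegral.

(** * Dilations and Euler's identity *)

Section RealDerivative.
Variable R : realType.
Implicit Types (f df : R -> R) (s t l : R).

Lemma is_derive1P f t l :
  is_derive t 1 f l <-> (fun h => h^-1 * (f (h + t) - f t)) @ 0^' --> l.
Proof.
have quotientE : (fun h : R => h^-1 *: ((f \o shift t) (h *: 1) - f t)) =
    (fun h => h^-1 * (f (h + t) - f t)).
  by apply/funext => h; rewrite /= [h *: 1]mulr1.
split=> [[derf <-]|cvgf]; first by rewrite -quotientE; exact: derf.
split; first by rewrite /derivable quotientE; apply/cvg_ex; exists l.
by rewrite /derive quotientE; exact: cvg_lim.
Qed.

Lemma is_derive1_cvg_shift f t l :
  is_derive t 1 f l -> f (h + t) @[h --> 0^'] --> f t.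
Proof.
move=> [/derivable1_diffP/differentiable_continuous cf _].
apply: (cvg_comp (fun h => h + t) f) cf; apply: cvg_within_filter.
by rewrite -{2}[t]add0r; apply: cvgD; [exact: cvg_id|exact: cvg_cst].
Qed.

Lemma is_derive_expRM (a : R) : is_derive (0 : R) 1 (fun s => expR (a * s)) a.
Proof.
have linear : is_derive (0 : R) 1 ( *%R a) a.
  by rewrite -[X in is_derive _ _ _ X]mulr1; exact: is_deriveZ.
have exponential : is_derive (0 : R) 1 (expR \o *%R a) (expR (a * 0) * a).
  exact: is_derive1_comp.
by apply: (is_derive_eq exponential); rewrite mulr0 expR0 mul1r.
Qed.

Lemma MVT_from0 f df s : (forall t, is_derive t 1 f (df t)) ->
  exists2 c, `|c| <= `|s| & f s - f 0 = df c * s.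
Proof.
move=> der; have cont a b : {within `[a, b], continuous f}.
  by apply: derivable_within_continuous => t _; have [] := der t.
have [s0|s0] := leP 0 s.
- have [c] := MVT_segment s0 (fun t _ => der t) (cont _ _).
  rewrite subr0 in_itv/= => /andP[c0 cs] ->; exists c => //.
  by rewrite !ger0_norm.
- have [c] := MVT_segment (ltW s0) (fun t _ => der t) (cont _ _).
  rewrite sub0r mulrN in_itv/= => /andP[sc c0] MVT; exists c.
    by rewrite !ler0_norm ?lerN2// ltW.
  by rewrite -[LHS]opprB MVT opprK.
Qed.

End RealDerivative.

Section Dilation.
Variable R : realType.
Local Notation mu := (@lebesgue_measure R).

Definition dilate n (d : 'I_n -> R) (x : 'rV[R]_n) : 'rV[R]_n := \row_i (d i * x 0 i).

Lemma dilate_continuous n (d : 'I_n -> R) : continuous (dilate d).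
Proof.
apply: continuous_rowP => i; under eq_fun do rewrite mxE.
by move=> x; apply: continuousM; [exact: cst_continuous|exact: coord_continuous].
Qed.

Lemma dilate_norm_ge n (d : 'I_n -> R) (c : R) x : 0 < c -> (forall i, c <= d i) ->
  `|x| <= c^-1 * `|dilate d x|.
Proof.
move=> c0 cd; apply/row_norm_leP => [|i]; first by rewrite mulr_ge0// invr_ge0 ltW.
rewrite ler_pdivlMl// (le_trans _ (row_coord_norm_le _ i))// mxE normrM.
by rewrite ler_wpM2r// (le_trans (cd i))// ler_norm.
Qed.

Lemma vanishes_beyond_dilate n (d : 'I_n -> R) (c M : R) (g : 'rV[R]_n -> R) :
  0 < c -> (forall i, c <= d i) -> vanishes_beyond M g ->
  vanishes_beyond (c^-1 * M) (g \o dilate d).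
Proof.
move=> c0 cd gM x xM; apply: gM; rewrite -(@ltr_pM2l _ c^-1) ?invr_gt0//.
exact: lt_le_trans xM (dilate_norm_ge _ c0 cd).
Qed.

Lemma Cc_dilate n (d : 'I_n -> R) (g : 'rV[R]_n -> R) : (forall i, 0 < d i) ->
  Cc g -> Cc (g \o dilate d).
Proof.
move=> d0 [cg [M gM]]; split.
  by move=> x; apply: continuous_comp; [exact: dilate_continuous|exact: cg].
pose c := \big[Num.min/1]_i d i.
exists (c^-1 * M); apply: vanishes_beyond_dilate gM => [|i].
  exact: lt_bigmin.
exact: bigmin_inf (lexx _).
Qed.

Lemma RintRn_dilate n (d : 'I_n -> R) (g : 'rV[R]_n -> R) : (forall i, 0 < d i) -> Cc g ->
  RintRn (g \o dilate d) = (\prod_i d i)^-1 * RintRn g.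
Proof.
elim: n d g => [|n IH] d g d0 cg.
  by rewrite big_ord0 invr1 mul1r /=; congr (g _); apply/rowP => -[].
rewrite big_ord_recl /=.
transitivity
    (\int[mu]_t ((\prod_i d (lift ord0 i))^-1 * RintRn (slice g (d ord0 * t)))).
  apply: eq_Rintegral => t _.
  rewrite -(IH (fun i => d (lift ord0 i)))//; last exact: Cc_slice.
  congr RintRn; apply/funext => y; rewrite /slice /=; congr g; apply/rowP => i.
  rewrite mxE; case: (unliftP ord0 i) => [j|] ->; rewrite ?cons_rowS ?cons_row0//.
  by rewrite mxE.
have cG := Cc_RintRn_slice cg.
rewrite RintegralZl//; last exact: Cc_integrable (Cc_scale (d0 ord0) cG).
by rewrite (Rintegral_scale (d0 ord0) cG) invfM mulrCA mulrA.
Qed.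

End Dilation.

Section RadialFlow.
Variables (R : realType) (n k : nat).
Implicit Types (s t : R) (x : 'rV[R]_n) (g : 'rV[R]_n -> R).

Definition radial_rate s (i : 'I_n) : R := if (i < k)%N then expR s else 1.

Definition radial_flow s : 'rV[R]_n -> 'rV[R]_n := dilate (radial_rate s).

Lemma radial_rate_gt0 s i : 0 < radial_rate s i.
Proof. by rewrite /radial_rate; case: ifP => // _; exact: expR_gt0. Qed.

Lemma expRN1_le_radial_rate s i : `|s| <= 1 -> expR (- 1) <= radial_rate s i.
Proof.
rewrite ler_norml /radial_rate => /andP[s1 _].
by case: ifP => _; [rewrite ler_expR|rewrite -[leRHS]expR0 ler_expR lerN10].
Qed.

Lemma radial_flow0 x : radial_flow 0 x = x.
Proof. by apply/rowP => i; rewrite mxE /radial_rate expR0 if_same mul1r. Qed.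

Lemma radial_flowD s t x : radial_flow (s + t) x = radial_flow s (radial_flow t x).
Proof.
apply/rowP => i; rewrite !mxE /radial_rate.
by case: ifP => _; rewrite ?mul1r// expRD mulrA.
Qed.

Lemma radial_flow_continuous :
  continuous (fun sx : R * 'rV[R]_n => radial_flow sx.1 sx.2).
Proof.
apply: continuous_rowP => i; under eq_fun do rewrite mxE.
move=> [s x]; apply: (@continuousM _ _
  (fun sx : R * 'rV[R]_n => radial_rate sx.1 i) (fun sx => sx.2 0 i)).
  rewrite /radial_rate; case: (i < k)%N; last exact: cst_continuous.
  by apply: continuous_comp; [exact: cvg_fst|exact: continuous_expR].
by apply: (@continuous_comp _ _ _ snd (fun y : 'rV[R]_n => y 0 i));
  [exact: cvg_snd|exact: coord_continuous].
Qed.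

Lemma vanishes_beyond_radial_flow s (M : R) g : `|s| <= 1 -> vanishes_beyond M g ->
  vanishes_beyond (expR 1 * M) (g \o radial_flow s).
Proof.
move=> s1; rewrite -[expR 1]invrK -expRN; apply: vanishes_beyond_dilate.
  exact: expR_gt0.
by move=> i; exact: expRN1_le_radial_rate.
Qed.

Lemma Cc_radial_flow s g : Cc g -> Cc (g \o radial_flow s).
Proof. by apply: Cc_dilate => i; exact: radial_rate_gt0. Qed.

Lemma RintRn_radial_flow s g : (k <= n)%N -> Cc g ->
  RintRn (g \o radial_flow s) = expR (- k%:R * s) * RintRn g.
Proof.
move=> kn cg; rewrite RintRn_dilate//; last by move=> i; exact: radial_rate_gt0.
rewrite -big_mkcond/= -(big_ord_widen n (fun=> expR s) kn) prodr_const card_ord.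
by rewrite -expRM_natl mulNr expRN.
Qed.

Variables (g Xg : 'rV[R]_n -> R).
Hypotheses (Cc_g : Cc g) (Cc_Xg : Cc Xg).
Hypothesis derive_flow0 : forall x,
  is_derive (0 : R) 1 (fun s => g (radial_flow s x)) (Xg x).

Lemma is_derive_radial_flow s x :
  is_derive s 1 (fun s => g (radial_flow s x)) (Xg (radial_flow s x)).
Proof.
have shift0 : (fun t => g (radial_flow t x)) =
    (fun t => g (radial_flow t (radial_flow s x))) \o (fun t => t - s).
  by apply/funext => t /=; rewrite -radial_flowD subrK.
have dshift : is_derive s 1 (fun t => t - s) (1 - 0).
  by apply: is_deriveB.
have dflow : is_derive (s - s) 1 (fun t => g (radial_flow t (radial_flow s x)))
    (Xg (radial_flow s x)).
  by rewrite subrr.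
by rewrite shift0 -[Xg _]mulr1 -{2}[1]subr0; exact: is_derive1_comp.
Qed.

Lemma near_radial_flow_increment (e : R) : 0 < e ->
  \forall s \near (0 : R), forall x,
    `|g (radial_flow s x) - g x - s * Xg x| <= e * `|s|.
Proof.
move=> e0.
have /(_ _ e e0) := @Cc_near_dist_lt R R _ n radial_flow Xg 0 (expR (- 1))^-1 Cc_Xg
  radial_flow_continuous.
have proper : \forall s \near (0 : R), forall x,
    `|x| <= (expR (- 1))^-1 * `|radial_flow s x|.
  apply: filterS (nbhs0_le ltr01) => s s1 x; apply: dilate_norm_ge; first exact: expR_gt0.
  by move=> i; exact: expRN1_le_radial_rate.
move=> /(_ proper) /nbhs_ballP[d /= d0 near0].
apply/nbhs_ballP; exists d => //= s sd x.
have Xg_near c : `|c| <= `|s| -> `|Xg (radial_flow c x) - Xg x| <= e.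
  move=> cs; rewrite -{2}(radial_flow0 x); apply/ltW/near0.
  by move: sd; rewrite /ball/= !sub0r !normrN; exact: le_lt_trans.
have [c cs] := MVT_from0 s (is_derive_radial_flow ^~ x).
rewrite radial_flow0 => ->.
by rewrite [s * _]mulrC -mulrBl normrM ler_wpM2r// Xg_near.
Qed.

Lemma near_RintRn_radial_flow_increment (e : R) : 0 < e ->
  \forall s \near (0 : R),
    `|RintRn (g \o radial_flow s) - RintRn g - s * RintRn Xg| <= e * `|s|.
Proof.
have [M M0 gM] := Cc_radius Cc_g; have [N N0 XgN] := Cc_radius Cc_Xg.
pose L := Num.max (expR 1 * M) (Num.max M N).
have L0 : 0 < L by rewrite !lt_max M0 !orbT.
pose V := (2 * L) ^+ n; have V0 : 0 < V by rewrite exprn_gt0// mulr_gt0.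
move=> e0; have e'0 : 0 < e / V by rewrite divr_gt0.
apply: filterS2 (nbhs0_le ltr01) (near_radial_flow_increment e'0) => s s1 increment.
have [cgs cX] := (Cc_radial_flow s Cc_g, CcZ s Cc_Xg).
have cinc := CcB cgs Cc_g.
rewrite -RintRnZ// -(RintRnB cgs Cc_g) -(RintRnB cinc cX).
rewrite (_ : e * `|s| = e / V * `|s| * V); last by field; rewrite gt_eqF.
apply: normr_RintRn_le => //; first exact: CcB.
apply: vanishes_beyondB; first apply: vanishes_beyondB.
- exact/vanishes_beyond_maxl/vanishes_beyond_radial_flow.
- exact/vanishes_beyond_maxr/vanishes_beyond_maxl.
- by apply/vanishes_beyond_maxr/vanishes_beyond_maxr => x xN; rewrite XgN// mulr0.
Qed.

Lemma is_derive_RintRn_radial_flow :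
  is_derive (0 : R) 1 (fun s => RintRn (g \o radial_flow s)) (RintRn Xg).
Proof.
apply/is_derive1P/cvgrPdist_le => e e0; rewrite near_withinE.
apply: filterS (near_RintRn_radial_flow_increment e0) => h increment h0.
have flow0 : g \o radial_flow 0 = g by apply/funext => x /=; rewrite radial_flow0.
rewrite addr0 flow0 -(@ler_pM2r _ `|h|) ?normr_gt0// distrC -normrM mulrBl.
by rewrite mulrAC mulVf// mul1r [_ * h]mulrC.
Qed.

Lemma RintRn_euler : (k <= n)%N -> RintRn Xg = - k%:R * RintRn g.
Proof.
move=> kn; have [_ <-] := is_derive_RintRn_radial_flow.
rewrite (_ : (fun s => _) = RintRn g *: (fun s => expR (- k%:R * s))); last first.
  by apply/funext => s; rewrite RintRn_radial_flow// mulrC.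
have [_ ->] := is_deriveZ (RintRn g) (is_derive_expRM (- k%:R)).
by rewrite [LHS]mulrC.
Qed.

End RadialFlow.

(** * Powers of the modulus *)

Section Modulus.
Variable R : realType.
Implicit Types (z w : cplx R) (p s : R).

Lemma powR_subnK (a p : R) m : 0 <= a -> p != 0 ->
  a `^ (p - m%:R) * a ^+ m = a `^ p.
Proof.
by move=> a_ge0 p_neq0; rewrite -powR_mulrn// -powRD subrK// (negbTE p_neq0).
Qed.

Lemma powR_continuous_gt0 (a s : R) : 0 < a -> {for a, continuous (fun b => b `^ s)}.
Proof.
move=> a0; apply: differentiable_continuous; apply/derivable1_diffP.
by apply: derivable_powR; rewrite in_itv/= a0.
Qed.

Lemma normr_powR_continuous s : 0 < s -> continuous (fun a : R => `|a| `^ s).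
Proof.
move=> s0 a; have [->|] := eqVneq a 0; last first.
  rewrite -normr_gt0 => a0.
  apply: (@continuous_comp R R R (fun b => `|b|) (fun b => b `^ s)).
    exact: norm_continuous.
  exact: powR_continuous_gt0.
rewrite /continuous_at normr0 powR0 ?gt_eqF//; apply/cvgrPdist_lt => e e0.
apply/nbhs_ballP; exists (e `^ s^-1) => [|b] /=; first exact: powR_gt0.
rewrite /ball/= !sub0r !normrN => be; rewrite ger0_norm ?powR_ge0//.
have -> : e = (e `^ s^-1) `^ s by rewrite -powRrM mulVf ?gt_eqF// powRr1// ltW.
by rewrite gt0_ltr_powR// nnegrE// powR_ge0.
Qed.

Lemma cabs_ge0 z : 0 <= cabs z. Proof. exact: sqrtr_ge0. Qed.

Lemma sqr_cabs z : cabs z ^+ 2 = cRe_mul_conj z z.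
Proof. by rewrite sqr_sqrtr// addr_ge0// sqr_ge0. Qed.

Lemma cabs_eq0 z : (cabs z == 0) = (z == (0, 0)).
Proof.
rewrite -[LHS](expf_eq0 _ 2) sqr_cabs paddr_eq0 -?expr2 ?sqr_ge0// !sqrf_eq0.
by case: z.
Qed.

Lemma cabs0 : cabs (0, 0) = 0 :> R.
Proof. by apply/eqP; rewrite cabs_eq0. Qed.

Lemma cabsZ (a : R) z : cabs (Defs.cscale a z) = `|a| * cabs z.
Proof.
by rewrite /cabs /Defs.cscale/= !exprMn -mulrDr sqrtrM ?sqr_ge0// sqrtr_sqr.
Qed.

Lemma normr_cRe_mul_conj_le z w : `|cRe_mul_conj z w| <= cabs z * cabs w.
Proof.
rewrite -sqrtr_sqr -sqrtrM ?addr_ge0 ?sqr_ge0//.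
rewrite ler_sqrt ?mulr_ge0 ?addr_ge0 ?sqr_ge0// /cRe_mul_conj -subr_ge0.
have -> : (z.1 ^+ 2 + z.2 ^+ 2) * (w.1 ^+ 2 + w.2 ^+ 2) - (z.1 * w.1 + z.2 * w.2) ^+ 2
  = (z.1 * w.2 - z.2 * w.1) ^+ 2 by ring.
exact: sqr_ge0.
Qed.

Lemma Cp_expand p (xi eta : cplx R) : p != 0 ->
  Cp p xi eta = cabs xi `^ p + (p - 1) * cabs (csub xi eta) `^ p -
    p * (cabs (csub xi eta) `^ (p - 2) * cRe_mul_conj (csub xi eta) xi).
Proof.
move=> p_neq0; rewrite /Cp; have [->|_] := eqVneq xi eta.
  rewrite /csub !subrr cabs0 (powR0 p_neq0) /cRe_mul_conj/=.
  by rewrite !mul0r !(mulr0, addr0, subr0).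
have -> : cRe_mul_conj (csub xi eta) eta =
    cRe_mul_conj (csub xi eta) xi - cabs (csub xi eta) ^+ 2.
  by rewrite sqr_cabs /cRe_mul_conj/=; ring.
rewrite -(powR_subnK 2 (cabs_ge0 (csub xi eta)) p_neq0); ring.
Qed.

Lemma cvg_cabs (T : Type) (F : set_system T) {FF : Filter F} (f g : T -> R) (a b : R) :
  f @ F --> a -> g @ F --> b -> (fun t => cabs (f t, g t)) @ F --> cabs (a, b).
Proof.
move=> fa gb; apply: (@cvg_comp _ _ _ (fun t => f t ^+ 2 + g t ^+ 2) Num.sqrt F
  (nbhs (a ^+ 2 + b ^+ 2))); last exact: sqrt_continuous.
by apply: cvgD; exact: cvgM.
Qed.

(* [|z|^(p-2)] need not be continuous at 0, but [|z|^(p-2) <z, w>] is bounded by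
   [|z|^(p-1) |w|]. *)
Lemma cabs_powR_inner_continuous (T : topologicalType) (f1 f2 g1 g2 : T -> R) (x : T) p :
  1 < p -> {for x, continuous f1} -> {for x, continuous f2} ->
  {for x, continuous g1} -> {for x, continuous g2} ->
  {for x, continuous (fun y =>
    cabs (f1 y, f2 y) `^ (p - 2) * cRe_mul_conj (f1 y, f2 y) (g1 y, g2 y))}.
Proof.
move=> p_gt1 cf1 cf2 cg1 cg2; have cf := cvg_cabs cf1 cf2.
have [f0|f0] := eqVneq (cabs (f1 x, f2 x)) 0; last first.
  apply: cvgM; last by apply: cvgD; exact: cvgM.
  apply: (@continuous_comp _ _ _ (fun y => cabs (f1 y, f2 y)) (fun a => a `^ (p - 2)));
    first exact: cf.
  by apply: powR_continuous_gt0; rewrite lt_def f0 cabs_ge0.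
have pB1_gt0 : 0 < p - 1 by rewrite subr_gt0.
have [f10 f20] : (f1 x, f2 x) = (0, 0) by apply/eqP; rewrite -cabs_eq0 f0.
have inner0 : cRe_mul_conj (f1 x, f2 x) (g1 x, g2 x) = 0.
  by rewrite f10 f20 /cRe_mul_conj/= !mul0r addr0.
rewrite /prop_for /continuous_at inner0 mulr0; apply/norm_cvg0P.
apply: (@squeeze_cvgr _ _ _ _ (cst 0)
  (fun y => `|cabs (f1 y, f2 y)| `^ (p - 1) * cabs (g1 y, g2 y))).
- apply: nearW => y; rewrite normr_ge0 normrM ger0_norm ?powR_ge0//=.
  rewrite (ger0_norm (cabs_ge0 _)).
  have -> : cabs (f1 y, f2 y) `^ (p - 1) =
      cabs (f1 y, f2 y) `^ (p - 2) * cabs (f1 y, f2 y).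
    rewrite -(powR_subnK 1 (cabs_ge0 _) (lt0r_neq0 pB1_gt0)) expr1.
    by congr (_ `^ _ * _); ring.
  by rewrite -mulrA ler_wpM2l ?powR_ge0// normr_cRe_mul_conj_le.
- exact: cvg_cst.
- have -> : 0 = `|cabs (f1 x, f2 x)| `^ (p - 1) * cabs (g1 x, g2 x).
    by rewrite f0 normr0 powR0 ?gt_eqF// mul0r.
  apply: cvgM; last exact: cvg_cabs.
  apply: (@continuous_comp _ _ _ (fun y => cabs (f1 y, f2 y))
    (fun a => `|a| `^ (p - 1))); first exact: cf.
  exact: normr_powR_continuous.
Qed.

Lemma is_derive_cabs_powR0 (U V : R -> R) (t dU dV p : R) : 1 < p ->
  is_derive t 1 U dU -> is_derive t 1 V dV -> (U t, V t) = (0, 0) ->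
  is_derive t 1 (fun s => cabs (U s, V s) `^ p) 0.
Proof.
move=> p_gt1 derU derV [U0 V0]; have pB1_gt0 : 0 < p - 1 by rewrite subr_gt0.
have p_gt0 : 0 < p by exact: lt_trans p_gt1.
have /is_derive1P := derU; have /is_derive1P := derV; rewrite U0 V0.
under eq_fun do rewrite subr0; under [in X in _ -> X -> _]eq_fun do rewrite subr0.
move=> cvgV cvgU; apply/is_derive1P/norm_cvg0P; rewrite U0 V0 cabs0 powR0 ?gt_eqF//.
have quotientE (h : R) : `|h^-1 * (cabs (U (h + t), V (h + t)) `^ p - 0)| =
    cabs (h^-1 * U (h + t), h^-1 * V (h + t)) * `|cabs (U (h + t), V (h + t))| `^ (p - 1).
  rewrite subr0 normrM (ger0_norm (powR_ge0 _ _)) (ger0_norm (cabs_ge0 _)).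
  rewrite -(powR_subnK 1 (cabs_ge0 _) (lt0r_neq0 p_gt0)) expr1.
  rewrite -[X in _ = X * _]/(cabs (Defs.cscale h^-1 (U (h + t), V (h + t)))) cabsZ.
  by rewrite mulrA mulrAC.
rewrite (funext quotientE) -[X in _ --> X](mulr0 (cabs (dU, dV))).
apply: cvgM; first exact: cvg_cabs.
rewrite [X in _ --> X](_ : 0 = `|cabs (0, 0)| `^ (p - 1) :> R); last first.
  by rewrite cabs0 normr0 powR0 ?gt_eqF.
apply: (@cvg_comp _ _ _ _ (fun a => `|a| `^ (p - 1)) _ (nbhs (cabs (0, 0)))).
  have := is_derive1_cvg_shift derV; have := is_derive1_cvg_shift derU.
  by rewrite U0 V0 => U_to0 V_to0; exact: cvg_cabs.
exact: normr_powR_continuous.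
Qed.

Lemma is_derive_cabs_powR (U V : R -> R) (t dU dV p : R) : 1 < p ->
  is_derive t 1 U dU -> is_derive t 1 V dV ->
  is_derive t 1 (fun s => cabs (U s, V s) `^ p)
    (p * (cabs (U t, V t) `^ (p - 2) * cRe_mul_conj (U t, V t) (dU, dV))).
Proof.
move=> p_gt1 derU derV; have [z0|z0] := eqVneq (U t, V t) (0, 0).
  rewrite z0 /cRe_mul_conj/= !mul0r addr0 !mulr0.
  exact: is_derive_cabs_powR0 derU derV z0.
have cabs_powRE (s x : R) : cabs (U x, V x) `^ s = (U x ^+ 2 + V x ^+ 2) `^ (s / 2).
  by rewrite /cabs -powR12_sqrt ?addr_ge0 ?sqr_ge0// -powRrM mulrC.
have S0 : 0 < U t ^+ 2 + V t ^+ 2.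
  rewrite -[ltRHS]/(cRe_mul_conj (U t, V t) (U t, V t)) -sqr_cabs exprn_gt0//.
  by rewrite lt_def cabs_eq0 z0 cabs_ge0.
have derS : is_derive t 1 (fun s => U s ^+ 2 + V s ^+ 2)
    (2 * cRe_mul_conj (U t, V t) (dU, dV)).
  apply: (is_derive_eq (is_deriveD (is_deriveM derU derU) (is_deriveM derV derV))).
  by rewrite /cRe_mul_conj /GRing.scale/=; ring.
rewrite (_ : (fun s => _) =
    (fun a => a `^ (p / 2)) \o (fun s => U s ^+ 2 + V s ^+ 2)); last first.
  by apply/funext => s; rewrite cabs_powRE.
have derpow := is_derive1_powR (p / 2) S0.
apply: (is_derive_eq (is_derive1_comp _ _)); rewrite cabs_powRE.
rewrite (_ : (p - 2) / 2 = p / 2 - 1); last by field.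
by field.
Qed.

End Modulus.

Section Hoelder.
Variable R : realType.

Lemma weighted_AMGM (a b s t : R) : 0 <= a -> 0 <= b -> 0 < s -> 0 < t -> s + t = 1 ->
  a `^ s * b `^ t <= s * a + t * b.
Proof.
move=> a0 b0 s0 t0 st; have := @conjugate_powR R (a `^ s) (b `^ t) s^-1 t^-1.
rewrite !powR_ge0 !invr_gt0 s0 t0 !invrK st.
rewrite -!powRrM !divff ?gt_eqF// !powRr1// [a * _]mulrC [b * _]mulrC.
exact.
Qed.

Lemma scaled_AMGM (A B a b s t : R) : 0 < A -> 0 < B -> 0 <= a -> 0 <= b ->
  0 < s -> 0 < t -> s + t = 1 ->
  a `^ s * b `^ t <= A `^ s * B `^ t * (s / A * a + t / B * b).
Proof.
move=> A0 B0 a0 b0 s0 t0 st.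
have a'0 : 0 <= a / A by rewrite divr_ge0// ltW.
have b'0 : 0 <= b / B by rewrite divr_ge0// ltW.
have aE : a `^ s = A `^ s * (a / A) `^ s.
  by rewrite -powRM ?(ltW A0)// mulrC divfK ?gt_eqF.
have bE : b `^ t = B `^ t * (b / B) `^ t.
  by rewrite -powRM ?(ltW B0)// mulrC divfK ?gt_eqF.
rewrite aE bE mulrACA; apply: ler_wpM2l; first by rewrite mulr_ge0 ?powR_ge0.
by rewrite mulrAC -mulrA [_ / B * b]mulrAC -[_ * b / B]mulrA; exact: weighted_AMGM.
Qed.

Variable n : nat.
Implicit Types F G : 'rV[R]_n -> R.

Lemma Cc_powR F (s : R) : 0 < s -> (forall x, 0 <= F x) -> Cc F -> Cc (fun x => F x `^ s).
Proof.
move=> s0 F0 cF; rewrite (_ : (fun x => _) = (fun a => `|a| `^ s) \o F); last first.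
  by apply/funext => x /=; rewrite ger0_norm.
apply: Cc_comp cF; first by rewrite normr0 powR0// gt_eqF.
by move=> x; exact: normr_powR_continuous.
Qed.

Lemma RintRn_eq0 F : Cc F -> (forall x, 0 <= F x) -> ~~ (0 < RintRn F) -> F = fun=> 0.
Proof.
move=> cF F0 /negP intF; apply/funext => x; apply/eqP/negPn/negP => Fx; apply: intF.
by apply: (RintRn_gt0 (x0 := x)) => //; rewrite lt_def Fx F0.
Qed.

Lemma RintRn_hoelder F G (s t : R) : 0 < s -> 0 < t -> s + t = 1 ->
  (forall x, 0 <= F x) -> (forall x, 0 <= G x) -> Cc F -> Cc G ->
  RintRn (fun x => F x `^ s * G x `^ t) <= RintRn F `^ s * RintRn G `^ t.
Proof.
move=> s0 t0 st F0 G0 cF cG.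
have [intF0|/(RintRn_eq0 cF F0) ->] := boolP (0 < RintRn F); last first.
  under eq_fun do rewrite powR0 ?gt_eqF// mul0r.
  by rewrite RintRn_cst0 mulr_ge0 ?powR_ge0.
have [intG0|/(RintRn_eq0 cG G0) ->] := boolP (0 < RintRn G); last first.
  under eq_fun do rewrite [X in _ * X]powR0 ?gt_eqF// mulr0.
  by rewrite RintRn_cst0 mulr_ge0 ?powR_ge0.
have [cFs cGt] := (Cc_powR s0 F0 cF, Cc_powR t0 G0 cG).
have [cF' cG'] := (CcZ (s / RintRn F) cF, CcZ (t / RintRn G) cG).
have AMGM x := scaled_AMGM intF0 intG0 (F0 x) (G0 x) s0 t0 st.
apply: le_trans (ler_RintRn _ _ AMGM) _.
- by apply: CcMl => //; exact: Cc_continuous.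
- by apply: CcZ; exact: CcD.
rewrite RintRnZ; last exact: CcD.
by rewrite RintRnD// !RintRnZ// !divfK ?gt_eqF// st mulr1.
Qed.

End Hoelder.

(** * The bracket of a test function *)

Section RadialDerivative.
Variables (R : realType) (n k : nat).
Implicit Types (g : 'rV[R]_n -> R) (x v : 'rV[R]_n).

Lemma is_derive_line g x v : differentiable g x ->
  is_derive (0 : R) 1 (fun s : R => g (x + s *: v)) ('D_v g x).
Proof.
move=> dg; have dv : derivable g x v by exact: diff_derivable.
apply/is_derive1P; rewrite scale0r addr0.
have -> : (fun h : R => h^-1 * (g (x + (h + 0) *: v) - g x)) =
    (fun h : R => h^-1 *: ((g \o shift x) (h *: v) - g x)).
  by apply/funext => h /=; rewrite addr0 [x + _]addrC.
exact: dv.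
Qed.

Definition proj x : 'rV[R]_n := \row_i (if (i < k)%N then x 0 i else 0).

Lemma derive_proj g x : differentiable g x -> 'D_(proj x) g x = xgrad k g x.
Proof.
move=> dg; rewrite deriveE//.
have -> : proj x = \sum_(i < n | (i < k)%N) x 0 i *: delta_mx 0 i.
  rewrite [LHS]row_sum_delta [RHS]big_mkcond/=; apply: eq_bigr => i _.
  by rewrite mxE; case: ifP => // _; rewrite scale0r.
rewrite linear_sum; apply: eq_bigr => i _.
by rewrite linearZ/= /partial deriveE.
Qed.

Lemma radial_flow_line s x : radial_flow k s x = x + (expR s - 1) *: proj x.
Proof.
apply/rowP => i; rewrite !mxE /radial_rate.
by case: ifP => _; [ring|rewrite mulr0 addr0 mul1r].
Qed.

Lemma is_derive_xgrad g x : differentiable g x ->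
  is_derive (0 : R) 1 (fun s => g (radial_flow k s x)) (xgrad k g x).
Proof.
move=> dg; have dexp : is_derive (0 : R) 1 (fun s => expR s - 1) (expR 0 - 0).
  exact: is_deriveB.
have dline : is_derive (expR 0 - 1 : R) 1 (fun s => g (x + s *: proj x)) (xgrad k g x).
  by rewrite expR0 subrr -derive_proj//; exact: is_derive_line.
rewrite (_ : (fun s => _) = (fun s => g (x + s *: proj x)) \o (fun s => expR s - 1)).
  by apply: (is_derive_eq (is_derive1_comp _ _)); rewrite expR0 subr0 mulr1.
by apply/funext => s; rewrite /= radial_flow_line.
Qed.

Lemma xgrad_off_closed (A : set 'rV[R]_n) g x : closed A ->
  (forall y, ~ A y -> g y = 0) -> ~ A x -> xgrad k g x = 0.
Proof.
move=> cA g0 Ax; apply: big1 => i _; rewrite /partial (@near_eq_derive _ _ _ g (cst 0)).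
  by rewrite derive_cst mulr0.
by apply: filterS g0 (open_nbhs_nbhs (conj (closed_openC cA) Ax)).
Qed.

Lemma xnorm_ge0 x : 0 <= xnorm k x. Proof. exact: sqrtr_ge0. Qed.

Lemma sum_continuous (X : topologicalType) (P : pred 'I_n) (f : 'I_n -> X -> R) (x : X) :
  (forall i, {for x, continuous (f i)}) ->
  {for x, continuous (fun y => \sum_(i < n | P i) f i y)}.
Proof.
by move=> cf; apply: cvg_big => [|i _]; [exact: add_continuous|exact: cf].
Qed.

Lemma xnorm_continuous : continuous (@xnorm R n k).
Proof.
move=> x; apply: (@continuous_comp _ _ _
  (fun x : 'rV[R]_n => \sum_(i < n | (i < k)%N) x 0 i ^+ 2) Num.sqrt).
  apply: sum_continuous => i.
  apply: (@continuous_comp _ _ _ (fun x : 'rV[R]_n => x 0 i) (fun a : R => a ^+ 2)).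
    exact: coord_continuous.
  exact: exprn_continuous.
exact: sqrt_continuous.
Qed.

Lemma xnorm_powRM_continuous (e : R) g x : xnorm k x != 0 ->
  {for x, continuous g} -> {for x, continuous (fun y => xnorm k y `^ e * g y)}.
Proof.
move=> x0 cg; apply: (@continuousM _ _ (fun y => xnorm k y `^ e) g) => //.
apply: (@continuous_comp _ _ _ (@xnorm R n k) (fun a => a `^ e)).
  exact: xnorm_continuous.
by apply: powR_continuous_gt0; rewrite lt_def x0 xnorm_ge0.
Qed.

Lemma xnorm_radial_flow s x : xnorm k (radial_flow k s x) = expR s * xnorm k x.
Proof.
rewrite /xnorm -(gtr0_norm (expR_gt0 s)) -sqrtr_sqr -sqrtrM ?sqr_ge0// mulr_sumr.
by congr Num.sqrt; apply: eq_bigr => i ik; rewrite mxE /radial_rate ik exprMn.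
Qed.

Lemma xnorm_powR_radial_flow (e s : R) x :
  xnorm k (radial_flow k s x) `^ e = expR (e * s) * xnorm k x `^ e.
Proof. by rewrite xnorm_radial_flow powRM ?expR_ge0 ?xnorm_ge0// -expRM [s * e]mulrC. Qed.

Lemma smooth_differentiable g : smooth g -> forall x, differentiable g x.
Proof. by move=> sg x; exact: (sg [::] x). Qed.

Lemma smooth_continuous g : smooth g -> continuous g.
Proof.
by move=> sg x; apply: differentiable_continuous; exact: smooth_differentiable.
Qed.

Lemma smooth_xgrad_continuous g : smooth g -> continuous (xgrad k g).
Proof.
move=> sg x; apply: sum_continuous => i.
apply: (@continuousM _ _ (fun x : 'rV[R]_n => x 0 i) (partial g i)).
  exact: coord_continuous.
by apply: differentiable_continuous; exact: (sg [:: delta_mx 0 i] x).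
Qed.

End RadialDerivative.

Section TestFunctions.
Variables (R : realType) (n k : nat) (u v : 'rV[R]_n -> R).
Hypothesis test_uv : test_fun k u v.
Implicit Types (g : 'rV[R]_n -> R) (x : 'rV[R]_n) (s e : R).

Let smooth_u : smooth u. Proof. by case: test_uv. Qed.
Let smooth_v : smooth v. Proof. by case: test_uv => _ []. Qed.

Lemma test_fun_support : exists K : set 'rV[R]_n, [/\ compact K,
  K `<=` [set x | xnorm k x != 0] &
  forall x, ~ K x -> [/\ u x = 0, v x = 0, xgrad k u x = 0 & xgrad k v x = 0]].
Proof.
have [_ [_ [K [cK [KU uv0]]]]] := test_uv; exists K; split => // x Kx.
have clK : closed K by apply: compact_closed => //; exact: norm_hausdorff.
have [u0 v0] := uv0 x Kx.
by split => //; apply: (xgrad_off_closed k clK _ Kx) => y /uv0[].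
Qed.

Lemma Cc_test_fun g :
  (forall x, u x = 0 -> v x = 0 -> xgrad k u x = 0 -> xgrad k v x = 0 -> g x = 0) ->
  (forall x, xnorm k x != 0 -> {for x, continuous g}) -> Cc g.
Proof.
move=> g0 cg; have [K [cK KU uv0]] := test_fun_support.
by apply: (Cc_compact_support cK KU) => // x /uv0[*]; exact: g0.
Qed.

Lemma test_fun_axis x : xnorm k x = 0 -> (u x, v x) = (0, 0).
Proof.
move=> x0; have [K [_ KU uv0]] := test_fun_support.
have /uv0[-> ->] // : ~ K x by move=> /KU/=; rewrite x0 eqxx.
Qed.

Definition wdens s e x := (xnorm k x `^ e * cabs (u x, v x)) `^ s.

Lemma wdens_ge0 s e x : 0 <= wdens s e x. Proof. exact: powR_ge0. Qed.

Lemma wdensE s e x : wdens s e x = xnorm k x `^ (e * s) * cabs (u x, v x) `^ s.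
Proof. by rewrite /wdens powRM ?powR_ge0 ?cabs_ge0// -powRrM. Qed.

Lemma Cc_wdens s e : 0 < s -> Cc (wdens s e).
Proof.
move=> s_gt0; apply: (Cc_powR s_gt0).
  by move=> x; rewrite mulr_ge0 ?powR_ge0 ?cabs_ge0.
apply: Cc_test_fun => [x -> -> _ _|x x0]; first by rewrite cabs0 mulr0.
apply: xnorm_powRM_continuous => //.
by apply: (@cvg_cabs _ _ (nbhs x)); exact: smooth_continuous.
Qed.

Lemma wnormE s e : 0 < s -> wnorm k s e u v = RintRn (wdens s e) `^ s^-1.
Proof.
move=> s_gt0; rewrite /wnorm /LnormRn.
rewrite (_ : (fun x => _) = EFin \o wdens s e) ?intRn_EFin//; first exact: Cc_wdens.
by apply/funext => x /=; rewrite cabsZ ger0_norm ?powR_ge0.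
Qed.

Lemma wnorm_powR s e : 0 < s -> wnorm k s e u v `^ s = RintRn (wdens s e).
Proof.
move=> s_gt0; rewrite wnormE// -powRrM mulVf ?gt_eqF// powRr1//.
by apply: RintRn_ge0 => x; exact: wdens_ge0.
Qed.

Lemma wnorm_ge0 s e : 0 <= wnorm k s e u v.
Proof. exact: powR_ge0. Qed.

Section DilationField.
Variables (p e : R).
Hypothesis p_gt1 : 1 < p.

Let p_gt0 : 0 < p. Proof. exact: lt_trans p_gt1. Qed.

Definition radial_pairing x := xnorm k x `^ (e * p) * (cabs (u x, v x) `^ (p - 2) *
  cRe_mul_conj (u x, v x) (xgrad k u x, xgrad k v x)).

Lemma Cc_radial_pairing : Cc radial_pairing.
Proof.
apply: Cc_test_fun => [x u0 v0 _ _|x x0].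
  by rewrite /radial_pairing u0 v0 /cRe_mul_conj/= !mul0r addr0 !mulr0.
apply: xnorm_powRM_continuous => //.
by apply: cabs_powR_inner_continuous => //;
  first [exact: smooth_continuous|exact: smooth_xgrad_continuous].
Qed.

Lemma is_derive_wdens x :
  is_derive (0 : R) 1 (fun s => wdens p e (radial_flow k s x))
    (e * p * wdens p e x + p * radial_pairing x).
Proof.
have flow0 : radial_flow k 0 x = x := radial_flow0 k x.
have du := is_derive_xgrad k (smooth_differentiable smooth_u x).
have dv := is_derive_xgrad k (smooth_differentiable smooth_v x).
have := is_derive_cabs_powR p_gt1 du dv; rewrite flow0 => dcabs.
pose X := xnorm k x `^ (e * p).
rewrite (_ : (fun s => _) = X *: ((fun s => expR (e * p * s)) *
    (fun s => cabs (u (radial_flow k s x), v (radial_flow k s x)) `^ p))); last first.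
  by apply/funext => s; rewrite wdensE xnorm_powR_radial_flow [LHS]mulrAC [RHS]mulrC.
apply: (is_derive_eq (is_deriveZ X (is_deriveM (is_derive_expRM (e * p)) dcabs))).
by rewrite wdensE /radial_pairing -/X flow0 /= mulr0 expR0 /GRing.scale/=; ring.
Qed.

Lemma RintRn_radial_pairing : (k <= n)%N ->
  p * RintRn radial_pairing = - (k%:R + e * p) * RintRn (wdens p e).
Proof.
move=> kn; have [cd cc] := (Cc_wdens e p_gt0, Cc_radial_pairing).
have cX : Cc (fun x => e * p * wdens p e x + p * radial_pairing x).
  by apply: CcD; exact: CcZ.
have := RintRn_euler cd cX is_derive_wdens kn.
rewrite RintRnD ?RintRnZ//; try exact: CcZ.
by move=> /(canRL (addKr _)) ->; ring.
Qed.

End DilationField.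

Section Bracket.
Variables (p alpha : R).
Hypotheses (p_gt1 : 1 < p) (kn : (k <= n)%N).

Local Notation m := ((k%:R - alpha) / p).
Local Notation w := (- (alpha / p)).

Let p_gt0 : 0 < p. Proof. exact: lt_trans p_gt1. Qed.

Lemma gradwE x :
  gradw k p alpha u v x = Defs.cscale (xnorm k x `^ w) (xgrad k u x, xgrad k v x).
Proof. by rewrite powRN. Qed.

Lemma csub_gradw_shift x : csub (gradw k p alpha u v x) (gradw_shift k p alpha u v x) =
  Defs.cscale (- m * xnorm k x `^ w) (u x, v x).
Proof. by rewrite powRN /csub /Defs.cscale/=; congr pair; ring. Qed.

Lemma Cp_gradw x : Cp p (gradw k p alpha u v x) (gradw_shift k p alpha u v x) =
  cabs (gradw k p alpha u v x) `^ p + ((p - 1) * `|m| `^ p * wdens p w x +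
    p * m * `|m| `^ (p - 2) * radial_pairing p w x).
Proof.
rewrite Cp_expand ?gt_eqF// csub_gradw_shift -addrA; congr (_ + _).
rewrite cabsZ normrM normrN (ger0_norm (powR_ge0 _ _)) wdensE /radial_pairing.
rewrite !powRM ?mulr_ge0 ?powR_ge0 ?cabs_ge0// gradwE.
by rewrite powRrM -(powR_subnK 2 (powR_ge0 _ _) (lt0r_neq0 p_gt0)) /cRe_mul_conj/=; ring.
Qed.

Lemma Cc_gradw : Cc (fun x => cabs (gradw k p alpha u v x) `^ p).
Proof.
apply: (Cc_powR p_gt0); first by move=> x; exact: cabs_ge0.
under eq_fun do rewrite gradwE cabsZ ger0_norm ?powR_ge0//.
apply: Cc_test_fun => [x _ _ -> ->|x x0]; first by rewrite cabs0 mulr0.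
apply: xnorm_powRM_continuous => //.
by apply: (@cvg_cabs _ _ (nbhs x)); exact: smooth_xgrad_continuous.
Qed.

Lemma bracketE : bracket k p alpha u v = (`|m| * wnorm k p w u v) `^ p.
Proof.
have [[cd cc] cg] := (Cc_wdens w p_gt0, Cc_radial_pairing w p_gt1, Cc_gradw).
pose A := (p - 1) * `|m| `^ p; pose B := p * m * `|m| `^ (p - 2).
have [cA cB] := (CcZ A cd, CcZ B cc).
rewrite powRM ?wnorm_ge0// wnorm_powR// /bracket /LnormRn.
rewrite (_ : intRn _ =
    (RintRn (fun x => cabs (gradw k p alpha u v x) `^ p))%:E); last first.
  by rewrite -intRn_EFin.
rewrite -powRrM mulVf ?gt_eqF// powRr1; last by apply: RintRn_ge0 => x; exact: powR_ge0.
rewrite (_ : (fun x => _) = EFin \o (fun x => cabs (gradw k p alpha u v x) `^ p +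
    (A * wdens p w x + B * radial_pairing p w x))); last first.
  by apply/funext => x /=; rewrite Cp_gradw.
rewrite intRn_EFin/=; last by apply: CcD => //; exact: CcD.
rewrite !RintRnD//; last exact: CcD.
rewrite !RintRnZ//.
have -> : RintRn (radial_pairing p w) = - m * RintRn (wdens p w).
  apply: (mulfI (lt0r_neq0 p_gt0)); rewrite RintRn_radial_pairing//.
  by field; rewrite gt_eqF.
rewrite /A /B -(powR_subnK 2 (normr_ge0 m) (lt0r_neq0 p_gt0)) real_normK ?num_real//.
by ring.
Qed.

Lemma bracket_powR (delta : R) : bracket k p alpha u v `^ (delta / p) =
  `|m| `^ delta * wnorm k p w u v `^ delta.
Proof.
rewrite bracketE -powRrM [p * _]mulrC divfK ?gt_eqF//.
exact: powRM (normr_ge0 _) (wnorm_ge0 _ _).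
Qed.

End Bracket.

End TestFunctions.

(** * Interpolation and sharpness *)

Section Interpolation.
Variables (R : realType) (n k : nat) (u v : 'rV[R]_n -> R).
Variables (p q r delta e0 e1 : R).
Hypotheses (p_gt0 : 0 < p) (q_gt0 : 0 < q) (r_gt0 : 0 < r).
Hypothesis homogeneous : delta * r / p + (1 - delta) * r / q = 1.

Local Notation e := (delta * e0 + (1 - delta) * e1).

Lemma wnorm_interpolation_eq : delta = 0 \/ delta = 1 \/ (q = p /\ e1 = e0) ->
  wnorm k r e u v = wnorm k p e0 u v `^ delta * wnorm k q e1 u v `^ (1 - delta).
Proof.
have powR01 (N M : R) : 0 <= M -> N `^ 0 * M `^ 1 = M.
  by move=> M0; rewrite powRr0 mul1r powRr1.
have powR_split (N : R) : 0 <= N -> N `^ delta * N `^ (1 - delta) = N.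
  by move=> N0; rewrite -powRD addrC subrK ?oner_eq0// powRr1.
case=> [delta0|[delta1|[qp e10]]].
- have rq : r = q by apply: divr1_eq; rewrite -homogeneous delta0; ring.
  by rewrite delta0 mul0r add0r !subr0 mul1r rq powR01 ?wnorm_ge0.
- have rp : r = p by apply: divr1_eq; rewrite -homogeneous delta1; ring.
  by rewrite delta1 subrr mul0r addr0 mul1r rp mulrC powR01 ?wnorm_ge0.
- have rp : r = p by apply: divr1_eq; rewrite -homogeneous qp; ring.
  have eE : delta * e0 + (1 - delta) * e0 = e0 by ring.
  by rewrite qp rp e10 eE powR_split ?wnorm_ge0.
Qed.

Lemma le_powR_interpolation (N N0 N1 A A0 A1 : R) : 0 <= N -> 0 <= N0 -> 0 <= N1 ->
  N `^ r = A -> N0 `^ p = A0 -> N1 `^ q = A1 ->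
  A <= A0 `^ (delta * r / p) * A1 `^ ((1 - delta) * r / q) ->
  N <= N0 `^ delta * N1 `^ (1 - delta).
Proof.
move=> N_ge0 N0_ge0 N1_ge0 <- <- <-.
have -> : (N0 `^ p) `^ (delta * r / p) * (N1 `^ q) `^ ((1 - delta) * r / q) =
    (N0 `^ delta * N1 `^ (1 - delta)) `^ r.
  rewrite (powRM _ (powR_ge0 _ _) (powR_ge0 _ _)) -!powRrM.
  by congr (_ `^ _ * _ `^ _); rewrite mulrC divfK ?gt_eqF.
apply: contraTT; rewrite -!ltNge => /(gt0_ltr_powR r_gt0); apply; rewrite nnegrE//.
by rewrite mulr_ge0 ?powR_ge0.
Qed.

Hypotheses (test_uv : test_fun k u v) (delta01 : 0 <= delta <= 1).

Lemma wdens_interpolation x : 0 < delta < 1 ->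
  wdens k u v r e x = wdens k u v p e0 x `^ (delta * r / p) *
    wdens k u v q e1 x `^ ((1 - delta) * r / q).
Proof.
move=> /andP[delta_gt0 delta_lt1].
have onem_delta_gt0 : 0 < 1 - delta by rewrite subr_gt0.
have pd : p * (delta * r / p) = delta * r by rewrite mulrC divfK ?gt_eqF.
have qd : q * ((1 - delta) * r / q) = (1 - delta) * r by rewrite mulrC divfK ?gt_eqF.
rewrite /wdens -!powRrM pd qd; have [x0|x0] := eqVneq (xnorm k x) 0.
  by rewrite (test_fun_axis test_uv x0) cabs0 !mulr0 !powR0 ?mulr0// gt_eqF// mulr_gt0.
set X := xnorm k x in x0 *; set a := cabs _; have a0 : 0 <= a by exact: cabs_ge0.
rewrite !powRM ?powR_ge0// -!powRrM mulrACA -!powRD ?x0 ?implybT//; last first.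
  by rewrite -mulrDl addrC subrK mul1r gt_eqF.
by congr (_ `^ _ * _ `^ _); ring.
Qed.

Lemma wnorm_interpolation :
  wnorm k r e u v <= wnorm k p e0 u v `^ delta * wnorm k q e1 u v `^ (1 - delta).
Proof.
have [delta0|delta_neq0] := eqVneq delta 0.
  by rewrite wnorm_interpolation_eq ?lexx//; left.
have [delta1|delta_neq1] := eqVneq delta 1.
  by rewrite wnorm_interpolation_eq ?lexx//; right; left.
have inner : 0 < delta < 1 by rewrite !lt_neqAle eq_sym delta_neq0 delta_neq1.
have /andP[delta_gt0 delta_lt1] := inner.
have onem_delta_gt0 : 0 < 1 - delta by rewrite subr_gt0.
have [s0 t0] : 0 < delta * r / p /\ 0 < (1 - delta) * r / q.
  by split; rewrite divr_gt0// mulr_gt0.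
have [F0 G0] := (wdens_ge0 k u v p e0, wdens_ge0 k u v q e1).
have [cF cG] := (Cc_wdens test_uv e0 p_gt0, Cc_wdens test_uv e1 q_gt0).
have := RintRn_hoelder s0 t0 homogeneous F0 G0 cF cG.
rewrite -(funext (fun x => wdens_interpolation x inner)).
by apply: le_powR_interpolation (wnorm_powR test_uv e r_gt0)
  (wnorm_powR test_uv e0 p_gt0) (wnorm_powR test_uv e1 q_gt0); exact: wnorm_ge0.
Qed.

End Interpolation.

Section FlatFunctions.
Variable R : realType.
Implicit Types t : R.

(* [t^-m exp(-1/t)] for [t > 0], written as one exponential so that the chain
   rule gives the recurrence [is_derive_flat] at once. *)
Definition flat (m : nat) t : R :=
  if 0 < t then expR (- t^-1 - m%:R * ln t) else 0.

Lemma flat_ge0 m t : 0 <= flat m t.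
Proof. by rewrite /flat; case: ifP => // _; exact: expR_ge0. Qed.

Lemma flat_gt0 m t : 0 < t -> 0 < flat m t.
Proof. by rewrite /flat => ->; exact: expR_gt0. Qed.

Lemma flat_le0 m t : t <= 0 -> flat m t = 0.
Proof. by rewrite /flat ltNge => ->. Qed.

Lemma flatS m t : 0 < t -> flat m.+1 t = flat m t / t.
Proof.
move=> t0; have -> : flat m t / t = flat m t * expR (- ln t) by rewrite expRN lnK.
by rewrite /flat t0 -expRD; congr expR; rewrite -natr1; ring.
Qed.

Lemma flatE m t : 0 < t -> flat m t = expR (- t^-1) / t ^+ m.
Proof.
move=> t0; elim: m => [|m IH]; first by rewrite /flat t0 mul0r subr0 expr0 divr1.
by rewrite flatS// IH exprSr invfM mulrA.
Qed.

Lemma flat_le_sqr m t : flat m t <= m.+2`!%:R * t ^+ 2.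
Proof.
have [t0|t0] := leP t 0; first by rewrite flat_le0// mulr_ge0// sqr_ge0.
have fact0 : 0 < (m.+2`!%:R : R) by rewrite ltr0n fact_gt0.
rewrite flatE// expRN ler_pdivrMr ?exprn_gt0// -mulrA -exprD add2n.
have bound0 : 0 < m.+2`!%:R * t ^+ m.+2 by exact: mulr_gt0 (exprn_gt0 _ t0).
rewrite invf_ple ?posrE ?expR_gt0// invfM mulrC -exprVn.
apply: le_trans (expR_ge1Dxn m.+1 _); first by rewrite lerDr.
by rewrite invr_ge0 ltW.
Qed.

Lemma is_derive_flat_gt0 (m : nat) t : 0 < t ->
  is_derive t 1 (flat m) (flat m.+2 t - m%:R * flat m.+1 t).
Proof.
move=> t0; have -> : flat m.+2 t - m%:R * flat m.+1 t =
    expR (- t^-1 - m%:R * ln t) * (t ^- 2 - m%:R * t^-1).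
  rewrite !flatS// /flat t0; field; exact: lt0r_neq0.
apply: (@near_eq_is_derive _ _ _ (expR \o (fun s => - s^-1 - m%:R * ln s))).
  by near=> s; rewrite /flat (_ : 0 < s)//; near: s; exact: lt_nbhsr.
apply: is_derive1_comp.
have dinv : is_derive t 1 (fun s : R => s^-1) (- t ^- 2 *: 1).
  by apply: is_deriveV; rewrite ?gt_eqF.
have dln : is_derive t 1 (@ln R) t^-1 by exact: is_derive1_ln.
have -> : t ^- 2 - m%:R * t^-1 = - (- t ^- 2 *: 1) - m%:R *: t^-1.
  by rewrite [_ *: 1]mulr1 opprK.
exact: is_deriveB.
Unshelve. all: end_near. Qed.

Lemma is_derive_flat0 (m : nat) : is_derive (0 : R) 1 (flat m) 0.
Proof.
apply/is_derive1P/cvgrPdist_le => e e0; rewrite near_withinE.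
have C0 : 0 < (m.+2`!%:R : R) by rewrite ltr0n fact_gt0.
apply/nbhs_ballP; exists (e / m.+2`!%:R) => [|h] /=; first exact: divr_gt0.
rewrite /ball/= sub0r normrN ltr_pdivlMr// => he h0.
rewrite addr0 (flat_le0 _ (lexx 0)) subr0 sub0r normrN normrM normfV.
rewrite (ger0_norm (flat_ge0 _ _)) ler_pdivrMl ?normr_gt0//.
apply: (le_trans (flat_le_sqr _ _)).
rewrite -(real_normK (num_real h)) expr2 mulrCA ler_wpM2l// mulrC.
exact: ltW.
Qed.

Lemma is_derive_flat (m : nat) t :
  is_derive t 1 (flat m) (flat m.+2 t - m%:R * flat m.+1 t).
Proof.
have [t0|t0|->] := ltrgtP t 0; last 2 first.
- exact: is_derive_flat_gt0.
- by rewrite !flat_le0// mulr0 subr0; exact: is_derive_flat0.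
rewrite !flat_le0 ?ltW// mulr0 subr0; apply: (@near_eq_is_derive _ _ _ (cst 0)) => //.
by near=> s; rewrite flat_le0// ltW//; near: s; exact: lt_nbhsl.
Unshelve. all: end_near. Qed.

Variable n : nat.

Inductive elementary : ('rV[R]_n -> R) -> Prop :=
| elementary_cst c : elementary (cst c)
| elementary_coord i : elementary (fun x => x 0 i)
| elementary_add f g : elementary f -> elementary g -> elementary (f + g)
| elementary_mul f g : elementary f -> elementary g -> elementary (f * g)
| elementary_flat m f : elementary f -> elementary (flat m \o f).

Lemma derive_flat_comp m (f : 'rV[R]_n -> R) v : (forall x, differentiable f x) ->
  (forall x, differentiable (flat m \o f) x) /\
  'D_v (flat m \o f) = ((flat m.+2 \o f) + cst (- m%:R) * (flat m.+1 \o f)) * 'D_v f.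
Proof.
move=> df; have dflat t : differentiable (flat m) t.
  by apply/derivable1_diffP; have [] := is_derive_flat m t.
have dcomp x : differentiable (flat m \o f) x by exact: differentiable_comp.
split=> //; apply/funext => x; rewrite deriveE// diff_comp//= diff1E// derive1E.
have [_ ->] := is_derive_flat m (f x); rewrite -deriveE//.
rewrite -[RHS]/((flat m.+2 (f x) + - m%:R * flat m.+1 (f x)) * 'D_v f x).
by rewrite -[LHS]/('D_v f x * _); ring.
Qed.

Lemma elementary_derive (f : 'rV[R]_n -> R) : elementary f ->
  (forall x, differentiable f x) /\ (forall v, elementary ('D_v f)).
Proof.
elim=> {f} [c|i|f g ef [df Df] eg [dg Dg]|f g ef [df Df] eg [dg Dg]|m f ef [df Df]].
- split=> [x|v]; first exact: differentiable_cst.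
  have -> : 'D_v (cst c) = cst 0 :> ('rV[R]_n -> R).
    by apply/funext => x; rewrite derive_cst.
  exact: elementary_cst.
- split=> [x|v]; first exact: differentiable_coord.
  have -> : 'D_v (fun x : 'rV[R]_n => x 0 i) = cst (v 0 i).
    apply/funext => x; apply: cvg_lim => //; apply: (@cvg_near_cst _ _ _ _ (0^')).
    rewrite near_withinE; apply: nearW => h h0 /=.
    by rewrite !mxE addrK -[_ *: _]/(_ * _) mulKf.
  exact: elementary_cst.
- split=> [x|v]; first exact: differentiableD.
  have -> : 'D_v (f + g) = 'D_v f + 'D_v g.
    by apply/funext => x; rewrite deriveD//; exact: diff_derivable.
  exact: elementary_add.
- split=> [x|v]; first exact: differentiableM.
  have -> : 'D_v (f * g) = f * 'D_v g + g * 'D_v f.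
    by apply/funext => x; rewrite deriveM//; exact: diff_derivable.
  by apply: elementary_add; exact: elementary_mul.
- split=> [x|v]; first exact: (derive_flat_comp m 0 df).1.
  rewrite (derive_flat_comp m v df).2; apply: elementary_mul => //.
  apply: elementary_add; first exact: elementary_flat.
  by apply: elementary_mul; [exact: elementary_cst|exact: elementary_flat].
Qed.

Lemma elementary_smooth (f : 'rV[R]_n -> R) : elementary f -> smooth f.
Proof.
move=> ef vs; elim: vs f ef => [|v vs IH] f ef x /=.
  by have [] := elementary_derive ef.
by apply: IH; have [_] := elementary_derive ef.
Qed.

Lemma elementary_prod (I : Type) (s : seq I) (f : I -> 'rV[R]_n -> R) :
  (forall i, elementary (f i)) -> elementary (\prod_(i <- s) f i).
Proof.
move=> ef; elim: s => [|i s IH]; first by rewrite big_nil; exact: elementary_cst.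
by rewrite big_cons; exact: elementary_mul.
Qed.

End FlatFunctions.

Section Bump.
Variables (R : realType) (n : nat).

Definition bump (x : 'rV[R]_n) : R := \prod_i (flat 0 (x 0 i - 1) * flat 0 (2 - x 0 i)).

Lemma bump_smooth : smooth bump.
Proof.
apply: elementary_smooth.
pose tent i := (flat 0 \o ((fun x : 'rV[R]_n => x 0 i) + cst (- 1))) *
  (flat 0 \o (cst 2 + cst (- 1) * (fun x : 'rV[R]_n => x 0 i))).
have -> : bump = \prod_i tent i.
  apply/funext => x; rewrite fct_prodE; apply: eq_bigr => i _.
  by rewrite -[RHS]/(flat 0 _ * flat 0 (2 + -1 * x 0 i)) mulN1r.
apply: elementary_prod => i; apply: elementary_mul; apply: elementary_flat;
  apply: elementary_add; try exact: elementary_cst; try exact: elementary_coord.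
by apply: elementary_mul; [exact: elementary_cst|exact: elementary_coord].
Qed.

Lemma bump_gt0 : 0 < bump (const_mx (3 / 2)).
Proof. by apply: prodr_gt0 => i _; rewrite mxE mulr_gt0// flat_gt0//; lra. Qed.

Lemma bump_support (x : 'rV[R]_n) :
  ~ (forall i, `[1, 2]%classic (x 0 i)) -> bump x = 0.
Proof.
move=> /existsNP[i]; rewrite /= in_itv/= => /negP; rewrite negb_and -!ltNge => xi.
rewrite /bump (bigD1 i)//=; case/orP: xi => xi.
  by rewrite flat_le0 ?mul0r// subr_le0 ltW.
by rewrite [flat 0 (2 - _)]flat_le0 ?mulr0 ?mul0r// subr_le0 ltW.
Qed.

Lemma xnorm_gt0 k (x : 'rV[R]_n) (i : 'I_n) : (i < k)%N -> 0 < x 0 i -> 0 < xnorm k x.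
Proof.
move=> ik xi; rewrite sqrtr_gt0 (bigD1 i)//= ltr_pwDl ?exprn_gt0//.
by rewrite sumr_ge0// => j _; rewrite sqr_ge0.
Qed.

Lemma exists_test_fun k : (1 <= k <= n)%N -> exists u v : 'rV[R]_n -> R,
  test_fun k u v /\ forall s e : R, 0 < s -> 0 < wnorm k s e u v.
Proof.
move=> /andP[k1 kn]; pose i0 : 'I_n := Ordinal (leq_trans k1 kn).
have tf : test_fun k bump (cst 0).
  split; first exact: bump_smooth.
  split; first exact/elementary_smooth/elementary_cst.
  exists [set x | forall i, `[1, 2]%classic (x 0 i)]; split.
    by apply: (@rV_compact R n (fun=> `[1, 2]%classic)) => i; exact: segment_compact.
  split=> [x /(_ i0)/=|x /bump_support//].
  rewrite in_itv/= => /andP[x1 _]; rewrite gt_eqF// (xnorm_gt0 (i := i0))//.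
  exact: lt_le_trans x1.
exists bump, (cst 0); split => // s e s0; rewrite (wnormE tf)// powR_gt0//.
apply: (RintRn_gt0 (x0 := const_mx (3 / 2))); first exact: Cc_wdens.
  by move=> x; exact: wdens_ge0.
rewrite powR_gt0// mulr_gt0//.
  by rewrite powR_gt0// (xnorm_gt0 (i := i0))// mxE; lra.
by rewrite lt_def cabs_ge0 cabs_eq0 xpair_eqE gt_eqF ?bump_gt0.
Qed.

End Bump.

Theorem theorem5p1 (R : realType) (n k : nat) (p q r delta alpha b c : R) :
  (1 <= k <= n)%N -> 1 < p -> 1 < q -> 0 < r -> r <= p + q ->
  0 <= delta <= 1 -> (r - q) / r <= delta <= p / r ->
  delta * r / p + (1 - delta) * r / q = 1 ->
  c = - delta + b * (1 - delta) ->
  (forall u v : 'rV[R]_n -> R, test_fun k u v ->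
     0 <= bracket k p alpha u v /\
     `|(k%:R - alpha) / p| `^ delta * wnorm k r (alpha * c / p) u v
       <= bracket k p alpha u v `^ (delta / p)
          * wnorm k q (alpha * b / p) u v `^ (1 - delta)) /\
  (alpha != k%:R ->
   ((q = p /\ b = -1) \/ delta = 0 \/ delta = 1) ->
   forall K : R, `|(k%:R - alpha) / p| `^ delta < K ->
   exists u v : 'rV[R]_n -> R, test_fun k u v /\
     bracket k p alpha u v `^ (delta / p)
       * wnorm k q (alpha * b / p) u v `^ (1 - delta)
     < K * wnorm k r (alpha * c / p) u v).
Proof.
move=> kn1 p_gt1 q_gt1 r_gt0 _ delta01 _ homogeneous ->; have /andP[_ kn] := kn1.
have [p_gt0 q_gt0] : 0 < p /\ 0 < q by split; exact: lt_trans ltr01 _.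
have -> : alpha * (- delta + b * (1 - delta)) / p =
  delta * (- (alpha / p)) + (1 - delta) * (alpha * b / p) by ring.
split=> [u v test_uv|_ sharp_case K mK].
  split; first by rewrite bracketE// powR_ge0.
  rewrite bracket_powR// -[leRHS]mulrA; apply: ler_wpM2l; first exact: powR_ge0.
  exact: wnorm_interpolation.
have [u [v [test_uv wnorm_gt0]]] := exists_test_fun R kn1.
exists u, v; split=> //; rewrite bracket_powR// -mulrA.
have endpoint : delta = 0 \/ delta = 1 \/ (q = p /\ alpha * b / p = - (alpha / p)).
  case: sharp_case => [[-> ->]|[]]; [right; right|by left|by right; left].
  by split=> //; ring.
by rewrite -(wnorm_interpolation_eq k u v homogeneous endpoint) ltr_pM2r ?wnorm_gt0.
Qed.
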